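(* Let $n\geq 2$ be an integer, let $k\geq 1$ be real, and let $P(z)=\sum_{j=0}^{n}a_jz^j$ be a complex polynomial of degree $n$ all of whose zeros lie in $|z|\leq k$. Then $$\max_{|z|=1}|P'(z)|\geq \frac{1}{1+k^{n}}\left(n+\frac{k^{n}|a_n|-|a_0|}{k^{n}|a_n|+|a_0|}\right)\max_{|z|=1}|P(z)|+\frac{|a_{n-1}|}{k(1+k^{n})}\left(n+\frac{k^{n}|a_n|-|a_0|}{k^{n}|a_n|+|a_0|}\right)\phi(k)+|a_1|\psi(k),$$ where $\phi(k)=\frac{k^{n}-1}{n}-\frac{k^{n-2}-1}{n-2}$ and $\psi(k)=1-\frac{1}{k^2}$ if $n>2$, while $\phi(k)=\frac{(k-1)^2}{2}$ and $\psi(k)=1-\frac{1}{k}$ if $n=2$. The result is best possible: equality holds for $P(z)=z^n+k^n$.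
   Context: Polynomials are in one complex variable with complex coefficients; $P$ of degree $n$ means $a_n\neq 0$. *)

(* Defs.v *)
From HB Require Import structures.
From mathcomp Require Import all_boot all_order all_algebra.
From mathcomp.real_closed Require Import complex.
From mathcomp Require Import all_classical all_reals all_analysis.

Set Implicit Arguments.
Unset Strict Implicit.
Unset Printing Implicit Defensive.

Import Order.TTheory GRing.Theory Num.Theory.
Import numFieldTopology.Exports numFieldNormedType.Exports.
(* [normc : R[i] -> R] is the real-valued modulus; the generic [`|z|] on R[i]
   takes its values in R[i]. *)
Export Normc.

Local Open Scope classical_set_scope.
Local Open Scope ring_scope.

(* The maximum of |p(z)| over |z| = 1, written as a supremum; [circle_maxP]
   below shows that it is attained. *)
Definition circle_max (R : realType) (p : {poly R[i]}) : R :=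
  sup [set normc p.[z] | z in [set z : R[i] | normc z = 1]].

Definition zeros_in_disk (R : realType) (p : {poly R[i]}) (k : R) : Prop :=
  forall z : R[i], root p z -> normc z <= k.

Definition phi (R : realType) (n : nat) (k : R) : R :=
  if n == 2%N then (k - 1) ^+ 2 / 2
  else (k ^+ n - 1) / n%:R - (k ^+ (n - 2) - 1) / (n - 2)%:R.

Definition psi (R : realType) (n : nat) (k : R) : R :=
  if n == 2%N then 1 - 1 / k else 1 - 1 / k ^+ 2.

Definition derivative_bound (R : realType) (n : nat) (k : R)
    (P : {poly R[i]}) : R :=
  let a j := normc P`_j in
  let c := n%:R + (k ^+ n * a n - a 0%N) / (k ^+ n * a n + a 0%N) in
  1 / (1 + k ^+ n) * c * circle_max P
  + a n.-1 / (k * (1 + k ^+ n)) * c * phi n k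
  + a 1%N * psi n k.

Lemma horner_circle_continuous (R : realType) (p : {poly R[i]}) :
  exists u v : R -> R, [/\ continuous u, continuous v &
    forall t, p.[Complex (cos t) (sin t)] = Complex (u t) (v t)].
Proof.
elim/poly_ind: p => [|p [a b] [u [v [cu cv E]]]].
  exists (cst 0), (cst 0); split; [exact: cst_continuous..|].
  by move=> t; rewrite horner0.
exists (fun t => u t * cos t - v t * sin t + a),
       (fun t => u t * sin t + v t * cos t + b); split.
- move=> t; apply: cvgD; last exact: cvg_cst.
  by apply: cvgB; apply: cvgM; [exact: cu|exact: continuous_cos|exact: cv|exact: continuous_sin].
- move=> t; apply: cvgD; last exact: cvg_cst.
  by apply: cvgD; apply: cvgM; [exact: cu|exact: continuous_sin|exact: cv|exact: continuous_cos].
- by move=> t; rewrite hornerMXaddC E.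
Qed.

Lemma normc1_polar (R : realType) (z : R[i]) : normc z = 1 ->
  exists2 t : R, t \in `[- pi, pi] & z = Complex (cos t) (sin t).
Proof.
case: z => x y /= /(congr1 (fun s => s ^+ 2)).
rewrite sqr_sqrtr ?addr_ge0 ?sqr_ge0// expr1n => xy1.
have x1 : -1 <= x <= 1.
  rewrite -ler_norml -(@ler_sqr R) ?nnegrE// expr1n real_normK ?num_real//.
  by rewrite -xy1 lerDl sqr_ge0.
have p0 : 0 <= pi :> R by exact: pi_ge0.
have a0 := acos_ge0 x1; have api := acos_lepi x1.
have y2 : Num.sqrt (1 - x ^+ 2) = `|y|.
  by rewrite -xy1 addrAC subrr add0r sqrtr_sqr.
have [y0|y0] := leP 0 y.
  exists (acos x); first by rewrite in_itv /= api andbT (le_trans _ a0)// oppr_le0.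
  by rewrite acosK ?in_itv//= sin_acos// y2 ger0_norm.
exists (- acos x).
  by rewrite in_itv /= lerN2 api /= (le_trans _ p0)// oppr_le0.
by rewrite cosN sinN acosK ?in_itv//= sin_acos// y2 ltr0_norm// opprK.
Qed.

Lemma circle_maxP (R : realType) (p : {poly R[i]}) :
  (exists2 z : R[i], normc z = 1 & normc p.[z] = circle_max p) /\
  (forall z : R[i], normc z = 1 -> normc p.[z] <= circle_max p).
Proof.
have [u [v [cu cv E]]] := horner_circle_continuous p.
pose f t := Num.sqrt (u t ^+ 2 + v t ^+ 2).
have cf : continuous f.
  move=> t; apply: continuous_comp; last exact: sqrt_continuous.
  by apply: cvgD; rewrite /GRing.exp/=; apply: cvgM; (exact: cu || exact: cv).
have [c _ fc] : exists2 c : R, c \in `[- pi, pi] &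
    forall t, t \in `[- pi, pi] -> f t <= f c.
  apply: EVT_max; last exact: continuous_subspaceT.
  by rewrite (@le_trans _ _ 0)// ?oppr_le0 pi_ge0.
pose w : R[i] := Complex (cos c) (sin c).
have w1 : normc w = 1 by rewrite /= cos2Dsin2 sqrtr1.
have fw : normc p.[w] = f c by rewrite E.
have ub z : normc z = 1 -> normc p.[z] <= normc p.[w].
  by move=> /normc1_polar [t tI ->]; rewrite fw E; exact: fc.
have -> : circle_max p = normc p.[w].
  apply/eqP; rewrite eq_le; apply/andP; split.
    by apply: ge_sup => [|_ [z z1 <-]]; [exists (normc p.[w]), w|exact: ub].
  apply: ub_le_sup; last by exists w.
  by exists (normc p.[w]) => _ [z z1 <-]; exact: ub.
by split=> //; exists w.
Qed.

(* Main.v *)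
Require Import Defs.
From mathcomp Require Import all_boot all_order all_algebra.
From mathcomp Require Import separable.
From mathcomp.real_closed Require Import complex polyrcf.
From mathcomp Require Import all_classical all_reals all_analysis.
From mathcomp Require Import ring lra.
From HB Require Import structures.

(** Put G(z) = P(kz), whose zeros lie in the closed unit disk, let
    H(w) = w^n G(1/w) be its reversal, and let c be the factor
    n + (k^n |a_n| - |a_0|) / (k^n |a_n| + |a_0|).  Maxima are over |z| = 1.

    The bound is obtained by comparing the circles |z| = 1 and |z| = k.

    - On the unit circle, Re (z G'(z) / G(z)) is the sum over the zeros x of
      Re (1 / (1 - x/z)), hence at least the sum of 1 / (1 + |x|), which is at
      least c/2 ([sum_inv_ge]).  Therefore max |G'| >= c/2 max |G|
      ([deriv_lower]), where G'(z) = k P'(kz).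

    - A polynomial p of degree at most m grows by less than the factor r^m
      when its constant term is not zero ([growth_bound]): at |z| = r >= 1,
      |p(z)| is at most r^m max |p| - (r^m - r^(m-d)) |p(0)|, d = min(2, m).
      For p = P', m = n-1 and r = k this bounds max |P'| below by a
      value of |P'| on |z| = k, and produces the term |a_1| psi(k).

    - Since |z G'| >= |n G - z G'| on the circle, |z H'| <= |n H - z H'| there;
      together with |z H'| + |n H - z H'| <= n max |H| ([riesz_bound]) this
      gives |H'| <= n/2 max |H|.  Growing H' by [growth_bound] and integrating
      along a radius from 1 to k bounds max |H(k z)| = k^n max |P| by
      (1 + k^n)/2 max |G| - phi(k) |h_1|, where |h_1| = k^(n-1) |a_(n-1)|
      ([reversal_growth]).  So max |G| is large compared with max |P|.

    Chaining the three gives the theorem ([derivative_lower_bound]).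

    The two sharp inequalities [growth_bound] and [riesz_bound] both come from
    one principle ([quadrature_bound]): a linear functional L on polynomials of
    degree at most m which vanishes on some D of degree m with m simple zeros
    is, by Lagrange interpolation, a combination of the values at those zeros,
    which are unimodular here.  If the weights are positive up to a phase, L is
    bounded by max |p| with the constant read off from a single test
    polynomial.  Both are thus algebra at finitely many points, with neither
    contour integrals nor the maximum principle.

    For z^n + k^n one has a_1 = a_(n-1) = 0 (as n >= 2) and c = n, so the bound
    is n / (1 + k^n) times max |z^n + k^n| = 1 + k^n, which is max |n z^(n-1)|. *)

Set Implicit Arguments.
Unset Strict Implicit.
Unset Printing Implicit Defensive.

Import Order.TTheory GRing.Theory Num.Theory.
Local Open Scope ring_scope.

(** * Positive quadrature *)

(** The functional only sees the values of its argument at the zeros of D,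
    because L kills D and the Lagrange basis spans a complement of the line
    of D.  The sign condition says that u T(x) turns each weight into a
    nonnegative number, so L T realises the sum of their moduli.  The test
    polynomial T is there because the weights may carry a phase that varies
    with the node. *)
Lemma quadrature_bound (C : numClosedFieldType) (D T p : {poly C})
    (L : {poly C} -> C) (u M : C) :
  scalar L -> `|u| = 1 -> D \is monic ->
  (forall x, root D x -> D^`().[x] != 0) -> L D = 0 ->
  (forall x, root D x -> `|T.[x]| = 1) ->
  (forall x, root D x -> 0 <= u * T.[x] * (L (D %/ ('X - x%:P)) / D^`().[x])) ->
  (size T <= size D)%N -> (size p <= size D)%N ->
  (forall x, root D x -> `|p.[x]| <= M) ->
  `|L p| <= M * `|L T|.
Proof.
move=> Llin u1 Dmon Dsimple LD T1 wpos sT sp pM.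
pose L' : {scalar {poly C}} := HB.pack L (GRing.isLinear.Build _ _ _ _ L Llin).
have LD_ q1 q2 : L (q1 + q2) = L q1 + L q2 by exact: (raddfD L').
have LZ a q : L (a *: q) = a * L q by exact: (linearZ_LR L').
have Lsum (r : seq C) F : L (\sum_(x <- r) F x) = \sum_(x <- r) L (F x).
  exact: (raddf_sum L').
have [s Ds] := closed_field_poly_normal D.
rewrite (monicP Dmon) scale1r in Ds.
have rootD x : root D x = (x \in s) by rewrite Ds root_prod_XsubC.
have sD : size D = (size s).+1 by rewrite Ds size_prod_XsubC.
have DQ x : root D x -> D = D %/ ('X - x%:P) * ('X - x%:P).
  by move=> rx; rewrite divpK // dvdp_XsubCl.
have D'Q x : root D x -> D^`().[x] = (D %/ ('X - x%:P)).[x].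
  move=> rx; rewrite [in LHS](DQ x rx) derivM derivXsubC mulr1.
  by rewrite hornerD hornerM hornerXsubC subrr mulr0 add0r.
have us : uniq s.
  rewrite -separable_prod_XsubC -Ds unlock.
  by apply/Pdiv.ClosedField.coprimepP => x; exact: Dsimple.
pose l x := (D^`().[x])^-1 *: (D %/ ('X - x%:P)).
have lxy x y : x \in s -> y \in s -> (l x).[y] = (x == y)%:R.
  move=> xs ys; rewrite hornerZ; have [<-|nxy] := eqVneq x y.
    by rewrite -D'Q ?rootD // mulVf // Dsimple // rootD.
  have /eqP := ys; rewrite -rootD => /eqP/rootP.
  rewrite {1}(DQ x) ?rootD // hornerM hornerXsubC => /eqP.
  rewrite eq_sym in nxy.
  by rewrite mulf_eq0 subr_eq0 (negPf nxy) orbF => /eqP ->; rewrite mulr0.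
have sl x : x \in s -> (size (l x) <= size s)%N.
  move=> xs; rewrite (leq_trans (size_scale_leq _ _)) //.
  by rewrite size_divp ?polyXsubC_eq0 // size_XsubC sD subn1.
have interp (q : {poly C}) : (size q <= size D)%N ->
    q = q`_(size s) *: D + \sum_(x <- s) q.[x] *: l x.
  move=> sq; apply/eqP; rewrite -subr_eq0; apply/eqP.
  apply: (@roots_geq_poly_eq0 _ _ s) => //.
    apply/allP => y ys; rewrite /root !hornerE horner_sum.
    have -> : D.[y] = 0 by apply/rootP; rewrite rootD.
    rewrite mulr0 add0r (bigD1_seq y) //= big_seq_cond big1 => [|x /andP[xs nxy]].
      by rewrite hornerZ lxy // eqxx mulr1 addr0 subrr.
    by rewrite hornerZ lxy // (negPf nxy) mulr0.
  apply/leq_sizeP => j; rewrite leq_eqVlt => /orP[/eqP <-|lt_sj]; rewrite coefB coefD coefZ.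
    have -> : D`_(size s) = 1 by rewrite -(monicP Dmon) lead_coefE sD.
    rewrite mulr1 coef_sum big_seq big1 => [|x xs]; first by rewrite addr0 subrr.
    by rewrite coefZ (leq_sizeP _ _ (sl x xs)) ?mulr0.
  rewrite [q`_j]nth_default ?(leq_trans sq) ?sD // [D`_j]nth_default ?sD //.
  rewrite mulr0 coef_sum big_seq big1 => [|x xs]; first by rewrite addr0 subrr.
  by rewrite coefZ (leq_sizeP _ _ (sl x xs)) ?mulr0 // ltnW.
have Lq (q : {poly C}) : (size q <= size D)%N -> L q = \sum_(x <- s) q.[x] * L (l x).
  move=> sq; rewrite {1}(interp q sq) LD_ LZ LD.
  by rewrite mulr0 add0r Lsum; apply: eq_bigr => x _; rewrite LZ.
have wE x : u * T.[x] * L (l x) = u * T.[x] * (L (D %/ ('X - x%:P)) / D^`().[x]).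
  by rewrite LZ [_^-1 * _]mulrC.
have -> : `|L T| = \sum_(x <- s) `|L (l x)|.
  rewrite -[LHS]mul1r -u1 -normrM Lq // mulr_sumr ger0_norm.
    rewrite big_seq [RHS]big_seq; apply: eq_bigr => x xs.
    by rewrite mulrA -[LHS]ger0_norm ?wE ?wpos ?rootD // -wE !normrM u1 T1 ?rootD // !mul1r.
  by rewrite big_seq sumr_ge0 // => x xs; rewrite mulrA wE wpos ?rootD.
rewrite Lq // (le_trans (ler_norm_sum _ _ _)) // mulr_sumr big_seq [leRHS]big_seq.
by apply: ler_sum => x xs; rewrite normrM ler_wpM2r // pM // rootD.
Qed.

(** * Growth of a polynomial outside the unit disk *)

Lemma norm_align (C : numClosedFieldType) (a b : C) :
  exists2 e : C, `|e| = 1 & `|a + e * b| = `|a| + `|b|.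
Proof.
have [->|a0] := eqVneq a 0.
  by exists 1; rewrite ?normr1 // mul1r normr0 !add0r.
have [->|b0] := eqVneq b 0.
  by exists 1; rewrite ?normr1 // mulr0 normr0 !addr0.
have na : `|a| != 0 by rewrite normr_eq0.
have nb : `|b| != 0 by rewrite normr_eq0.
exists (a / `|a| * (b / `|b|)^-1).
  by rewrite normrM normfV !normf_div !normr_id !divff ?oner_eq0.
have -> : a + a / `|a| * (b / `|b|)^-1 * b = (a / `|a|) * (`|a| + `|b|) by field; apply/and3P.
by rewrite normrM normf_div normr_id divff // mul1r ger0_norm ?addr_ge0.
Qed.

Lemma norm1_conj (C : numClosedFieldType) (z : C) : `|z| = 1 -> z^* = z^-1.
Proof. by move=> z1; rewrite [RHS]invC_norm z1 expr1n invr1 mul1r. Qed.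

(** The factor (z - r) / (1 - r z) of a Blaschke product has modulus below,
    equal to or above 1 exactly as z does when 0 <= r < 1; this is the identity
    behind it. *)
Lemma blaschke_identity (C : numClosedFieldType) (r z : C) : r \is Num.real ->
  `|1 - r * z| ^+ 2 - `|z - r| ^+ 2 = (1 - r ^+ 2) * (1 - `|z| ^+ 2).
Proof.
move=> /CrealP rr.
by rewrite !normCK !rmorphB !rmorphM rmorph1 /= rr; ring.
Qed.

(** Locates on the unit circle the solutions of z^j (z - r) / (1 - r z) = eta
    for unimodular eta: all factors on the left move to the same side of 1. *)
Lemma blaschke_unimodular (C : numClosedFieldType) (r z : C) (j : nat) :
  0 <= r < 1 -> `|z ^+ j * (z - r)| = `|1 - r * z| -> `|z| = 1.
Proof.
move=> /andP[r0 r1] E.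
have r2 : 0 < 1 - r ^+ 2 by rewrite subr_gt0 expr_lt1.
have id := blaschke_identity z (ger0_real r0).
have z_real : `|z| \is Num.real by exact: normr_real.
have : `|z| ^+ j * `|z - r| = `|1 - r * z| by rewrite -E normrM normrX.
have [lt1|gt1|//] := real_ltgtP z_real (real1 C) => E'.
- have : 0 < `|1 - r * z| ^+ 2 - `|z - r| ^+ 2.
    by rewrite id mulr_gt0 // subr_gt0 expr_lt1.
  rewrite subr_gt0 ltr_pXn2r ?nnegrE // -E' => /lt_le_trans - /(_ `|z - r|).
  by rewrite ltxx -[leRHS]mul1r ler_wpM2r ?exprn_ile1 // ?ltW // => /(_ isT).
- have : `|1 - r * z| ^+ 2 - `|z - r| ^+ 2 < 0.
    by rewrite id pmulr_rlt0 // subr_lt0 exprn_egt1.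
  rewrite subr_lt0 ltr_pXn2r ?nnegrE // -E' => /le_lt_trans - /(_ `|z - r|).
  by rewrite ltxx -[leLHS]mul1r ler_wpM2r ?exprn_ege1 // ?ltW // => /(_ isT).
Qed.

(** The nodes are the solutions of z^(j+1) (z - rho) = eta (1 - rho z) with
    rho = 1/r and eta = 1/e.  This choice of eta makes the functional vanish on
    the node polynomial D; its weight at a node x is x^-(j+2) times a positive
    number, so the test polynomial 'X^(j+2) absorbs the phases. *)
Lemma growth_at (C : numClosedFieldType) (j : nat) (r M e : C) (p : {poly C}) :
  1 < r -> `|e| = 1 -> (size p <= j.+3)%N ->
  (forall z, `|z| = 1 -> `|p.[z]| <= M) ->
  `|p.[r] + e * (r ^+ j.+2 - r ^+ j) * p`_0| <= M * r ^+ j.+2.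
Proof.
move=> r1 e1 sp pM.
have r0 : 0 < r by exact: lt_trans ltr01 r1.
have rN0 : r != 0 by rewrite gt_eqF.
have e0 : e != 0 by rewrite -normr_gt0 e1.
set rho := r^-1; set eta := e^-1.
have rho0 : 0 < rho by rewrite invr_gt0.
have rho1 : rho < 1 by rewrite invf_lt1.
have rhoC : rho^* = rho by apply/CrealP; rewrite gtr0_real.
set A := r ^+ j.+2 - r ^+ j.
have A0 : 0 < A by rewrite subr_gt0 ltr_eXn2l.
pose D : {poly C} := 'X^(j.+2) - rho *: 'X^(j.+1) + (eta * rho) *: 'X - eta%:P.
have DE x : D.[x] = x ^+ j.+2 - rho * x ^+ j.+1 + eta * rho * x - eta.
  by rewrite !hornerE.
have D'E x : D^`().[x] = j.+2%:R * x ^+ j.+1 - rho * (j.+1%:R * x ^+ j) + eta * rho.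
  rewrite /D derivB derivC subr0 derivD derivB !derivZ !derivXn derivX.
  by rewrite -['X^_ *+ j.+2]scaler_nat -['X^_ *+ j.+1]scaler_nat !hornerE.
have sD : size D = j.+3.
  rewrite /D -2!addrA size_polyDl ?size_polyXn //.
  rewrite (leq_ltn_trans (size_polyD _ _)) // gtn_max size_polyN.
  rewrite (leq_ltn_trans (size_scale_leq _ _)) ?size_polyXn //=.
  rewrite (leq_ltn_trans (size_polyD _ _)) // gtn_max size_polyN.
  rewrite (leq_ltn_trans (size_scale_leq _ _)) ?size_polyX //=.
  by rewrite (leq_ltn_trans (size_polyC_leq1 _)).
have Dmon : D \is monic.
  by rewrite monicE lead_coefE sD /= !coefE eqxx /= gtn_eqF // !mulr0 subr0 addr0 subr0.
have rootE x : root D x -> x ^+ j.+1 * (x - rho) = eta * (1 - rho * x).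
  move=> /rootP; rewrite DE => Dx; apply/eqP; rewrite -subr_eq0 -[X in _ == X]Dx.
  by apply/eqP; rewrite !exprS; ring.
have root1 x : root D x -> `|x| = 1.
  move=> /rootE E; apply: (@blaschke_unimodular _ rho _ j.+1).
    by rewrite rho1 ltW.
  by rewrite E normrM normfV e1 invr1 mul1r.
(* At a node, T x is the derivative of D times 1 - rho x, up to a unimodular factor. *)
pose T x := j.+1%:R * `|1 - rho * x| ^+ 2 + (1 - rho ^+ 2).
have T0 x : 0 < T x.
  by rewrite ltr_wpDl ?mulr_ge0 ?ler0n ?exprn_ge0 // subr_gt0 expr_lt1 // ltW.
have rxN x : `|x| = 1 -> 1 - rho * x != 0.
  move=> x1; rewrite subr_eq0; apply: contraL rho1 => /eqP /(congr1 Num.norm).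
  by rewrite normr1 normrM x1 mulr1 gtr0_norm // => <-; rewrite ltxx.
have key x : root D x -> D^`().[x] * (1 - rho * x) = x ^+ j.+1 * T x.
  move=> rx; have x1 := root1 x rx.
  have x0 : x != 0 by rewrite -normr_gt0 x1.
  rewrite /T normCK rmorphB rmorphM rmorph1 /= rhoC norm1_conj // D'E.
  rewrite mulrDl [eta * rho]mulrC -[rho * eta * _]mulrA -rootE // !exprS.
  by rewrite -!natr1; field.
have -> : r ^+ j.+2 = `|('X^(j.+2) : {poly C}).[r] + e * A * ('X^(j.+2) : {poly C})`_0|.
  by rewrite hornerXn coefXn /= mulr0 addr0 gtr0_norm ?exprn_gt0.
apply: (@quadrature_bound _ D 'X^(j.+2) p (fun q => q.[r] + e * A * q`_0) 1) => //.
- by move=> a q1 q2; rewrite !hornerE !coefE /=; ring.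
- by rewrite normr1.
- move=> x rx; have x1 := root1 x rx.
  apply/eqP => D'0; have := key x rx; rewrite D'0 mul0r => /esym/eqP.
  by rewrite mulf_eq0 expf_eq0 -normr_eq0 x1 oner_eq0 (gt_eqF (T0 x)) andbF.
- rewrite DE !coefE /= !mulr0 !subr0 !addr0 add0r exprS /A /rho /eta.
  by rewrite [r ^+ j.+1]exprS [r ^+ j.+2]exprS [r ^+ j.+1]exprS; field; rewrite e0.
- by move=> x /root1 x1; rewrite hornerXn normrX x1 expr1n.
- move=> x rx; have x1 := root1 x rx.
  have x0 : x != 0 by rewrite -normr_gt0 x1.
  have DQ : D = D %/ ('X - x%:P) * ('X - x%:P) by rewrite divpK // dvdp_XsubCl.
  have Nrx : r - x != 0.
    by have := rxN x x1; apply: contra; rewrite subr_eq0 => /eqP <-; rewrite mulVf ?subrr.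
  have Qr : (D %/ ('X - x%:P)).[r] = A / (r - x).
    apply: (mulIf Nrx); rewrite divfK //.
    have := congr1 (horner^~ r) DQ; rewrite /= hornerM hornerXsubC => <-.
    by rewrite DE /A !exprS /rho; field.
  have Q0 : (D %/ ('X - x%:P))`_0 = eta / x.
    apply: (mulIf x0); rewrite divfK //.
    have := congr1 (horner^~ 0) DQ; rewrite /= hornerM hornerXsubC -[_`_0]horner_coef0 DE.
    by rewrite !expr0n /= !mulr0 !subr0 !add0r mulrN => /oppr_inj.
  have -> : D^`().[x] = x ^+ j.+1 * T x / (1 - rho * x).
    by rewrite -key // mulfK // rxN.
  have T0' := T0 x; have TN : T x != 0 by rewrite gt_eqF.
  rewrite Qr Q0 hornerXn mul1r.
  have -> : x ^+ j.+2 * ((A / (r - x) + e * A * (eta / x)) / (x ^+ j.+1 * T x / (1 - rho * x)))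
     = A / T x.
    have := rxN x x1; rewrite /eta /rho => Nrho.
    by rewrite exprS; field; rewrite TN rN0 Nrx expf_eq0 (negPf x0) e0 andbF.
  by rewrite divr_ge0 // ltW.
- by rewrite size_polyXn sD.
- by rewrite sD.
- by move=> x /root1 /pM.
Qed.

Section Rotation.
Variables (C : numClosedFieldType) (p : {poly C}) (c : C).

Lemma horner_dilate x : (p \Po (c *: 'X)).[x] = p.[c * x].
Proof. by rewrite horner_comp !hornerE. Qed.

Lemma coef_dilate i : (p \Po (c *: 'X))`_i = p`_i * c ^+ i.
Proof.
rewrite comp_polyE coef_sum.
under eq_bigr do rewrite exprZn !coefZ coefXn.
have [lt_ip|le_pi] := ltnP i (size p).
  rewrite (bigD1 (Ordinal lt_ip)) //= eqxx mulr1 big1 ?addr0 // => k.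
  by rewrite -val_eqE /= eq_sym => /negPf ->; rewrite !mulr0.
rewrite (nth_default _ le_pi) mul0r big1 // => k _.
by rewrite gtn_eqF ?mulr0 // (leq_trans (ltn_ord k)).
Qed.

Lemma size_dilate_le : (size (p \Po (c *: 'X)) <= size p)%N.
Proof.
by apply/leq_sizeP => i le_pi; rewrite coef_dilate nth_default ?mul0r.
Qed.

Lemma deriv_dilate x : (p \Po (c *: 'X))^`().[x] = c * p^`().[c * x].
Proof.
by rewrite deriv_comp derivZ derivX hornerM horner_comp !hornerZ hornerX hornerC mulr1 mulrC.
Qed.

End Rotation.

(** After a rotation this is [growth_at], with e chosen to align the two terms.
    Degree 1 is separate: the coefficient of |p(0)| is then r - 1, and the bound
    follows from max |p| = |p_0| + |p_1|. *)
Lemma growth_bound (C : numClosedFieldType) (m : nat) (r M z : C) (p : {poly C}) :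
  (0 < m)%N -> 1 <= r -> (size p <= m.+1)%N ->
  (forall z, `|z| = 1 -> `|p.[z]| <= M) -> `|z| = 1 ->
  `|p.[r * z]| + (r ^+ m - r ^+ (m - minn 2 m)) * `|p`_0| <= M * r ^+ m.
Proof.
move=> m0 r1 sp pM z1; have r0 : 0 <= r by exact: le_trans r1.
move: r1; rewrite le_eqVlt => /orP[/eqP <-|r1].
  by rewrite !expr1n subrr mul0r addr0 mulr1 pM // normrM normr1 mul1r.
case: m m0 sp => [//|[_ sp|m _ sp]].
  have pE x : p.[x] = p`_0 + x * p`_1.
    by rewrite (horner_coef_wide x sp) big_ord_recl big_ord1 /= mulr1 mulrC expr1.
  have [e e1 eE] := norm_align p`_0 p`_1.
  have := pM e e1; rewrite pE eE => le_M.
  rewrite subnn expr0 expr1 (le_trans _ (ler_wpM2r r0 le_M)) //.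
  rewrite pE (le_trans (lerD (ler_normD _ _) (lexx _))) // !normrM z1 mulr1 ger0_norm //.
  by rewrite le_eqVlt; apply/orP; left; apply/eqP; ring.
rewrite (minn_idPl _) // !subSS subn0.
have r0' : 0 <= r ^+ m.+2 - r ^+ m by rewrite subr_ge0 (ler_weXn2l (ltW r1)) ?leqW.
pose q := p \Po (z *: 'X).
have [e e1 eE] := norm_align q.[r] ((r ^+ m.+2 - r ^+ m) * q`_0).
have := @growth_at _ m r M e q r1 e1 (leq_trans (size_dilate_le _ _) sp).
rewrite -mulrA eE horner_dilate coef_dilate expr0 mulr1 normrM (ger0_norm r0') mulrC mulrC.
rewrite [z * r]mulrC; apply => w w1; rewrite horner_dilate pM //.
by rewrite normrM z1 w1 mulr1.
Qed.

(** * The derivative and its reversal on the unit circle *)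

(** The nodes are the zeros of 'X^n - 1/e; the weight at a node x is e times
    the Fejer-type quotient |1 - e|^2 / (n |1 - x|^2), so the constant polynomial is
    a suitable test.  When e = 1 the point 1 would itself be a node, but the
    functional reduces to n p(1). *)
Lemma riesz_at (C : numClosedFieldType) (n : nat) (M e : C) (p : {poly C}) :
  (0 < n)%N -> `|e| = 1 -> (size p <= n.+1)%N ->
  (forall z, `|z| = 1 -> `|p.[z]| <= M) ->
  `|p^`().[1] + e * (n%:R * p.[1] - p^`().[1])| <= M * n%:R.
Proof.
case: n => // n _ e1 sp pM.
have [->|eN1] := eqVneq e 1.
  rewrite mul1r addrC subrK normrM normr_nat mulrC ler_wpM2r ?ler0n //.
  by rewrite pM ?normr1.
have e0 : e != 0 by rewrite -normr_gt0 e1.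
set eta := e^-1.
have etaN1 : eta != 1 by rewrite /eta invr_eq1.
have eta1 : `|eta| = 1 by rewrite normfV e1 invr1.
pose D : {poly C} := 'X^(n.+1) - eta%:P.
have DE x : D.[x] = x ^+ n.+1 - eta by rewrite !hornerE.
have D'E x : D^`().[x] = n.+1%:R * x ^+ n.
  by rewrite /D derivB derivXn derivC subr0 hornerMn hornerXn mulr_natl.
have sD : size D = n.+2 by rewrite size_XnsubC.
have Dmon : D \is monic by rewrite monicXnsubC.
have rootE x : root D x -> x ^+ n.+1 = eta.
  by move=> /rootP /eqP; rewrite DE subr_eq0 => /eqP.
have root1 x : root D x -> `|x| = 1.
  move=> /rootE /(congr1 Num.norm); rewrite normrX eta1 => /eqP.
  by rewrite pexprn_eq1 // => /eqP.
have nN0 : n.+1%:R != 0 :> C by rewrite pnatr_eq0.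
pose L (q : {poly C}) := q^`().[1] + e * (n.+1%:R * q.[1] - q^`().[1]).
have L1 : L 1 = e * n.+1%:R by rewrite /L !hornerE derivC !hornerE; ring.
rewrite -/(L p).
have -> : n.+1%:R = `|L 1| by rewrite L1 normrM e1 mul1r normr_nat.
apply: (@quadrature_bound _ D 1 p L eta) => //.
- move=> a q1 q2; rewrite /L derivD derivZ !(hornerD, hornerZ); ring.
- move=> x /root1 x1; rewrite D'E mulf_eq0 (negPf nN0) expf_eq0 -normr_eq0 x1.
  by rewrite oner_eq0 andbF.
- by rewrite /L D'E DE !expr1n /eta; field.
- by move=> x _; rewrite hornerC normr1.
- move=> x rx; have x1 := root1 x rx.
  have x0 : x != 0 by rewrite -normr_gt0 x1.
  have xN1 : 1 - x != 0.
    rewrite subr_eq0; apply: contra etaN1 => /eqP x1'.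
    by rewrite -(rootE x rx) -x1' expr1n.
  have DQ : D = D %/ ('X - x%:P) * ('X - x%:P) by rewrite divpK // dvdp_XsubCl.
  have Q1 : (D %/ ('X - x%:P)).[1] = (1 - eta) / (1 - x).
    apply: (mulIf xN1); rewrite divfK //.
    have := congr1 (horner^~ 1) DQ; rewrite /= hornerM hornerXsubC => <-.
    by rewrite DE expr1n.
  have Q'1 : (D %/ ('X - x%:P))^`().[1] = (n.+1%:R - (1 - eta) / (1 - x)) / (1 - x).
    apply: (mulIf xN1); rewrite divfK //.
    have := congr1 (fun q => q^`().[1]) DQ.
    rewrite /= derivM derivXsubC mulr1 hornerD hornerM hornerXsubC Q1 D'E expr1n mulr1.
    by move=> ->; rewrite addrK.
  have -> : D^`().[x] = n.+1%:R * eta / x.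
    by rewrite D'E -(rootE x rx) exprSr mulrA mulfK.
  rewrite /L Q1 Q'1 hornerC mulr1.
  have -> : eta * (((n.+1%:R - (1 - eta) / (1 - x)) / (1 - x) +
     e * (n.+1%:R * ((1 - eta) / (1 - x)) - (n.+1%:R - (1 - eta) / (1 - x)) / (1 - x)))
       / (n.+1%:R * eta / x)) = `|1 - e| ^+ 2 / (n.+1%:R * `|1 - x| ^+ 2).
    rewrite !normCK !rmorphB !rmorph1 /= !norm1_conj // /eta.
    by field; rewrite x0 nat1r nN0 xN1 e0 subr_eq0 [x == 1]eq_sym -subr_eq0 xN1.
  by rewrite divr_ge0 ?mulr_ge0 ?ler0n ?exprn_ge0.
- by rewrite size_poly1 sD.
- by rewrite sD.
- by move=> x /root1 /pM.
Qed.

(** A refinement of the Bernstein inequality: the second summand is the modulus of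
    the derivative of the reversal of p, at the inverse point. *)
Lemma riesz_bound (C : numClosedFieldType) (n : nat) (M z : C) (p : {poly C}) :
  (0 < n)%N -> (size p <= n.+1)%N ->
  (forall z, `|z| = 1 -> `|p.[z]| <= M) -> `|z| = 1 ->
  `|p^`().[z]| + `|n%:R * p.[z] - z * p^`().[z]| <= M * n%:R.
Proof.
move=> n0 sp pM z1; pose q := p \Po (z *: 'X).
have [e e1 eE] := norm_align q^`().[1] (n%:R * q.[1] - q^`().[1]).
have := @riesz_at _ n M e q n0 e1 (leq_trans (size_dilate_le _ _) sp).
rewrite eE horner_dilate deriv_dilate mulr1 normrM z1 mul1r; apply => w w1.
by rewrite horner_dilate pM // normrM z1 w1 mulr1.
Qed.

(** * Logarithmic derivative of a polynomial with zeros in the unit disk *)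

(** The inverse map sends the circle |v| = a to a circle meeting the real axis
    perpendicularly at 1 / (1 + a) and 1 / (1 - a). *)
Lemma Re_inv_ge (C : numClosedFieldType) (v : C) : `|v| <= 1 -> v != 1 ->
  (1 + `|v|)^-1 <= 'Re (1 - v)^-1.
Proof.
move=> v1 vN1; set a := `|v|; set w := v^*.
have a0 : 0 <= a by exact: normr_ge0.
have aN : 1 + a != 0 by rewrite gt_eqF // ltr_wpDr.
have vN : 1 - v != 0 by rewrite subr_eq0 eq_sym.
have wN : 1 - w != 0.
  by rewrite -(conjC1 C) -rmorphB fmorph_eq0.
have vw : v * w = a * a by rewrite -normCK expr2.
have at0 : 0 <= a + 'Re v.
  rewrite -lerBlDr sub0r -raddfN /a -normrN.
  by have [] := leif_Re_Creal (- v).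
have n0 : 0 <= (1 - v) * (1 - w) by rewrite /w -[X in X - v^*](conjC1 C) -rmorphB mul_conjC_ge0.
rewrite -subr_ge0.
have -> : 'Re (1 - v)^-1 - (1 + a)^-1 = (a + 'Re v) * (1 - a) / ((1 + a) * ((1 - v) * (1 - w))).
  rewrite !ReE fmorphV rmorphB rmorph1 -/w.
  have E : (a + (v + w) / 2) * (1 - a) = (1 - (v + w) / 2) * (1 + a) - (1 - v) * (1 - w).
    rewrite (_ : (1 - v) * (1 - w) = 1 - v - w + v * w); last by ring.
    by rewrite vw; field.
  by rewrite E; field; rewrite vN wN aN.
apply: divr_ge0; first by rewrite mulr_ge0 // subr_ge0.
by rewrite mulr_ge0 // addr_ge0.
Qed.

Lemma Re_logder_ge (C : numClosedFieldType) (s : seq C) (z : C) :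
  (forall x, x \in s -> `|x| <= 1) -> `|z| = 1 -> z \notin s ->
  let G := \prod_(x <- s) ('X - x%:P) in
  \sum_(x <- s) (1 + `|x|)^-1 <= 'Re (z * G^`().[z] / G.[z]).
Proof.
move=> s1 z1 /=; elim: s s1 => [|x s IH] s1.
  by rewrite !big_nil derivC horner0 mulr0 mul0r raddf0.
rewrite in_cons negb_or => /andP[zx zs]; rewrite !big_cons.
set G := \prod_(y <- s) _ in IH *.
have Gz : G.[z] != 0 by move: zs; rewrite -root_prod_XsubC.
have zN : z - x != 0 by rewrite subr_eq0.
have z0 : z != 0 by rewrite -normr_gt0 z1.
have -> : z * (('X - x%:P) * G)^`().[z] / (('X - x%:P) * G).[z]
    = (1 - x / z)^-1 + z * G^`().[z] / G.[z].
  rewrite derivM derivXsubC mul1r hornerD !hornerM hornerXsubC.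
  by field; rewrite Gz z0 zN.
rewrite raddfD /= lerD //; last by apply: IH => // y ys; rewrite s1 // in_cons ys orbT.
have nxz : `|x / z| = `|x| by rewrite normf_div z1 divr1.
rewrite -nxz Re_inv_ge // ?nxz ?s1 ?mem_head //.
by apply: contra zx => /eqP xz; rewrite -[z]mul1r -xz divfK.
Qed.

(** Merging two zeros of moduli a and b into one of modulus a b and one of
    modulus 1 does not increase the sum, since
    1/(1+a) + 1/(1+b) - 1/2 - 1/(1+ab) is a positive multiple of
    (1-ab)(1-a)(1-b).  After all mergers the zeros have moduli P, 1, ..., 1. *)
Lemma sum_inv_ge (C : numClosedFieldType) (s : seq C) :
  (forall x, x \in s -> `|x| <= 1) ->
  let P := \prod_(x <- s) `|x| in
  ((size s)%:R + (1 - P) / (1 + P)) / 2 <= \sum_(x <- s) (1 + `|x|)^-1.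
Proof.
move=> s1 /=; set P := \prod_(_ <- _) _.
suff [P0 P1 ge] : [/\ 0 <= P, P <= 1 &
    (size s)%:R / 2 - 2^-1 + (1 + P)^-1 <= \sum_(x <- s) (1 + `|x|)^-1].
  apply: le_trans ge; have PN : 1 + P != 0 by rewrite gt_eqF // ltr_wpDr.
  by rewrite le_eqVlt; apply/orP; left; apply/eqP; field.
rewrite {}/P; elim: s s1 => [|x s IH] s1.
  by rewrite !big_nil; split=> //; rewrite mul0r sub0r addNr.
have [|b0 b1 ge] := IH; first by move=> y ys; rewrite s1 // in_cons ys orbT.
rewrite !big_cons; set b := \prod_(_ <- _) _ in b0 b1 ge *.
have a0 : 0 <= `|x| by [].
have a1 : `|x| <= 1 by rewrite s1 ?mem_head.
set a := `|x| in a0 a1 *.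
split; [exact: mulr_ge0 | exact: mulr_ile1 |].
apply: le_trans (lerD (lexx _) ge).
have ab0 : 0 <= a * b by exact: mulr_ge0.
have aN : 1 + a != 0 by rewrite gt_eqF // ltr_wpDr.
have bN : 1 + b != 0 by rewrite gt_eqF // ltr_wpDr.
have abN : 1 + a * b != 0 by rewrite gt_eqF // ltr_wpDr.
have -> : (size (x :: s))%:R = (size s)%:R + 1 :> C by rewrite natr1.
rewrite -subr_ge0.
have -> : (1 + a)^-1 + ((size s)%:R / 2 - 2^-1 + (1 + b)^-1) -
     (((size s)%:R + 1) / 2 - 2^-1 + (1 + a * b)^-1)
   = (1 - a * b) * (1 - a) * (1 - b) / (2 * (1 + a) * (1 + b) * (1 + a * b)).
  by field; rewrite aN bN abN.
apply: divr_ge0; first by rewrite !mulr_ge0 ?subr_ge0 // mulr_ile1.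
by rewrite !mulr_ge0 ?ler0n // addr_ge0.
Qed.

Section ZerosInDisk.
Variables (C : numClosedFieldType) (n : nat) (G : {poly C}).
Hypotheses (sG : size G = n.+1) (G1 : forall x, root G x -> `|x| <= 1).

Let c : C := n%:R + (`|G`_n| - `|G`_0|) / (`|G`_n| + `|G`_0|).

Lemma roots_split : exists s : seq C, [/\ size s = n,
  (forall x, x \in s -> `|x| <= 1),
   G = G`_n *: \prod_(x <- s) ('X - x%:P) &
   `|G`_0| = `|G`_n| * \prod_(x <- s) `|x|].
Proof.
have [s Gs] := closed_field_poly_normal G.
have G0 : G != 0 by rewrite -size_poly_gt0 sG.
have lN0 : lead_coef G != 0 by rewrite lead_coef_eq0.
have lE : lead_coef G = G`_n by rewrite lead_coefE sG.
have ss : size s = n.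
  by move: sG; rewrite Gs size_scale // size_prod_XsubC => -[].
exists s; split=> //.
- by move=> x xs; apply: G1; rewrite Gs rootZ // root_prod_XsubC.
- by rewrite -lE.
rewrite -horner_coef0 [in LHS]Gs hornerZ horner_prod normrM lE; congr (_ * _).
rewrite normr_prod; apply: eq_bigr => x _.
by rewrite hornerXsubC sub0r normrN.
Qed.

Lemma leading_neq0 : G`_n != 0.
Proof.
have -> : G`_n = lead_coef G by rewrite lead_coefE sG.
by rewrite lead_coef_eq0 -size_poly_gt0 sG.
Qed.

(** The second inequality is |G_0| <= |G_n|, in the form in which
    [reverse_deriv_le] uses it. *)
Lemma Re_logder_bounds (z : C) : `|z| = 1 -> G.[z] != 0 ->
  c / 2 <= 'Re (z * G^`().[z] / G.[z]) /\ n%:R / 2 <= c / 2.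
Proof.
move=> z1 Gz; have [s [ss s1 Gs G0]] := roots_split.
have nN := leading_neq0; set Q := \prod_(x <- s) ('X - x%:P) in Gs.
have aN : `|G`_n| != 0 by rewrite normr_eq0.
have P0 : 0 <= \prod_(x <- s) `|x| by apply: prodr_ge0.
have P1 : \prod_(x <- s) `|x| <= 1.
  by rewrite big_seq; apply: prodr_ile1 => x xs; rewrite normr_ge0 s1.
have PN : 1 + \prod_(x <- s) `|x| != 0 by rewrite gt_eqF // ltr_wpDr.
have cE : c = n%:R + (1 - \prod_(x <- s) `|x|) / (1 + \prod_(x <- s) `|x|).
  rewrite /c G0; set P := \prod_(x <- s) _ in PN *; set l := `|_| in aN *.
  field; rewrite PN /=.
  by rewrite -[X in X + _]mulr1 -mulrDr mulf_neq0.
split; last first.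
  by rewrite ler_wpM2r ?invr_ge0 ?ler0n // cE lerDl divr_ge0 ?subr_ge0 ?addr_ge0.
have -> : z * G^`().[z] / G.[z] = z * Q^`().[z] / Q.[z].
  have : Q.[z] != 0 by apply: contraNneq Gz => Qz; rewrite Gs hornerZ Qz mulr0.
  by rewrite Gs derivZ !hornerZ => Qz; field; rewrite Qz.
apply: le_trans (Re_logder_ge s1 z1 _); last first.
  by apply: contra Gz => zs; rewrite -/(root G z) Gs rootZ // root_prod_XsubC.
by rewrite cE -{1}ss; apply: sum_inv_ge.
Qed.

Lemma deriv_lower (z : C) : `|z| = 1 -> c / 2 * `|G.[z]| <= `|G^`().[z]|.
Proof.
move=> z1; have [->|Gz] := eqVneq G.[z] 0; first by rewrite normr0 mulr0.
have [ge _] := Re_logder_bounds z1 Gz.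
rewrite -ler_pdivlMr ?normr_gt0 // (le_trans ge) //.
have -> : `|G^`().[z]| / `|G.[z]| = `|z * G^`().[z] / G.[z]|.
  by rewrite normf_div normrM z1 mul1r.
by have [] := leif_Re_Creal (z * G^`().[z] / G.[z]).
Qed.

(** The point q = z G'/G lies in the half-plane Re q >= n/2, where
    the distance to n does not exceed the distance to 0. *)
Lemma reverse_deriv_le (z : C) : `|z| = 1 ->
  `|n%:R * G.[z] - z * G^`().[z]| <= `|G^`().[z]|.
Proof.
move=> z1; have [->|Gz] := eqVneq G.[z] 0.
  by rewrite mulr0 sub0r normrN normrM z1 mul1r.
have [ge1 ge2] := Re_logder_bounds z1 Gz.
set q := z * G^`().[z] / G.[z] in ge1.
have zG : z * G^`().[z] = q * G.[z] by rewrite divfK.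
have -> : `|G^`().[z]| = `|q| * `|G.[z]| by rewrite -normrM -zG normrM z1 mul1r.
rewrite zG -mulrBl normrM ler_wpM2r // -(@ler_pXn2r _ 2) ?nnegrE //.
rewrite -subr_ge0 !normCK rmorphB /= conjC_nat.
have -> : q * q^* - (n%:R - q) * (n%:R - q^*) = n%:R * 2 * ('Re q - n%:R / 2).
  by rewrite ReE; field.
by rewrite !mulr_ge0 ?ler0n // subr_ge0 (le_trans ge2).
Qed.

End ZerosInDisk.

(** * Reversed polynomials *)

Section Reversal.
Variables (C : numClosedFieldType) (n : nat).
Implicit Types p G : {poly C}.

(** The Euler operator is diagonal on monomials, which makes the derivative of
    a reversal a mere reindexing. *)
Lemma euler_horner (m : nat) p (x : C) : (size p <= m)%N ->
  x * p^`().[x] = \sum_(i < m) i%:R * p`_i * x ^+ i.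
Proof.
case: m => [|m] sp.
  by move/size_poly_leq0P: sp => ->; rewrite big_ord0 derivC horner0 mulr0.
rewrite (@horner_coef_wide _ m); last first.
  by apply/leq_sizeP => i le_mi; rewrite coef_deriv nth_default ?mul0rn // (leq_trans sp).
rewrite big_ord_recl /= mul0r mul0r add0r mulr_sumr; apply: eq_bigr => i _.
by rewrite coef_deriv /bump /= exprS -mulr_natl; ring.
Qed.

Definition reversal (G : {poly C}) : {poly C} := \poly_(i < n.+1) G`_(n - i).

Lemma size_reversal G : (size (reversal G) <= n.+1)%N.
Proof. exact: size_poly. Qed.

Lemma horner_reversal G w : (size G <= n.+1)%N -> w != 0 ->
  (reversal G).[w] = w ^+ n * G.[w^-1].
Proof.
move=> sG w0; rewrite (horner_coef_wide _ sG) mulr_sumr.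
rewrite (horner_coef_wide _ (size_reversal G)) (reindex_inj rev_ord_inj).
apply: eq_bigr => -[i lt_in] _ /=.
rewrite subSS coef_poly ltnS leq_subr subKn; last by rewrite -ltnS.
by rewrite expfB_cond ?(negPf w0) // exprVn; ring.
Qed.

Lemma deriv_reversal G w : (size G <= n.+1)%N -> w != 0 ->
  w * (reversal G)^`().[w] = w ^+ n * (n%:R * G.[w^-1] - w^-1 * G^`().[w^-1]).
Proof.
move=> sG w0; rewrite (horner_coef_wide _ sG) (euler_horner _ sG).
rewrite (euler_horner _ (size_reversal G)) (reindex_inj rev_ord_inj).
rewrite mulr_sumr -sumrB mulr_sumr.
apply: eq_bigr => -[i lt_in] _ /=.
have le_in : (i <= n)%N by rewrite -ltnS.
rewrite subSS coef_poly ltnS leq_subr subKn //.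
by rewrite expfB_cond ?(negPf w0) // exprVn natrB //; ring.
Qed.

(** The Erdos-Lax inequality |H'| <= n/2 max |H| for H without zeros in the open
    disk, here written as a reversal.  Reversing exchanges z H' and n H - z H',
    so [reverse_deriv_le] makes |z H'| the smaller of the two summands in
    [riesz_bound]. *)
Lemma reversal_deriv_bound G (M z : C) : (0 < n)%N -> size G = n.+1 ->
  (forall x, root G x -> `|x| <= 1) ->
  (forall w, `|w| = 1 -> `|G.[w]| <= M) -> `|z| = 1 ->
  `|(reversal G)^`().[z]| <= M * n%:R / 2.
Proof.
move=> n0 sG G1 GM z1; have z0 : z != 0 by rewrite -normr_gt0 z1.
have sG' : (size G <= n.+1)%N by rewrite sG.
have nV (w : C) : `|w| = 1 -> `|w^-1| = 1 by move=> w1; rewrite normfV w1 invr1.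
have HM w : `|w| = 1 -> `|(reversal G).[w]| <= M.
  move=> w1; have w0 : w != 0 by rewrite -normr_gt0 w1.
  by rewrite horner_reversal // normrM normrX w1 expr1n mul1r GM // nV.
have := riesz_bound n0 (size_reversal G) HM z1.
have E1 : `|(reversal G)^`().[z]| = `|n%:R * G.[z^-1] - z^-1 * G^`().[z^-1]|.
  by rewrite -[LHS]mul1r -{1}z1 -normrM deriv_reversal // normrM normrX z1 expr1n mul1r.
have -> : `|n%:R * (reversal G).[z] - z * (reversal G)^`().[z]| = `|G^`().[z^-1]|.
  rewrite deriv_reversal // horner_reversal //.
  rewrite (_ : _ - _ = z ^+ n * (z^-1 * G^`().[z^-1])); last by ring.
  by rewrite !normrM normrX z1 (nV z) // expr1n !mul1r.
move=> le; rewrite ler_pdivlMr ?ltr0n // (le_trans _ le) //.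
rewrite mulr_natr mulr2n lerD2l E1.
by rewrite (reverse_deriv_le sG G1 (nV z z1)).
Qed.

End Reversal.

(** * Growth along a radius *)

Section RealPart.
Variable R : rcfType.
Local Open Scope complex_scope.

Definition re_poly (p : {poly R[i]}) : {poly R} := \poly_(i < size p) complex.Re p`_i.

Lemma coef_re_poly p i : (re_poly p)`_i = complex.Re p`_i.
Proof. by rewrite coef_poly; case: ltnP => // le_pi; rewrite nth_default. Qed.

Lemma horner_re_poly p t : (re_poly p).[t] = complex.Re p.[t%:C].
Proof.
rewrite horner_poly horner_coef raddf_sum; apply: eq_bigr => i _.
by rewrite -rmorphXn /=; case: (p`_i) => x y /=; rewrite mulr0 subr0.
Qed.

Lemma deriv_re_poly p : (re_poly p)^`() = re_poly p^`().
Proof.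
apply/polyP => i; rewrite coef_re_poly !coef_deriv coef_re_poly.
by rewrite raddfMn.
Qed.

Lemma normC_normc (z : R[i]) : `|z| = (normc z)%:C.
Proof. by []. Qed.

Lemma normc_ge0 (z : R[i]) : 0 <= normc z.
Proof. by case: z => x y; exact: sqrtr_ge0. Qed.

Lemma Re_le_normc (z : R[i]) : complex.Re z <= normc z.
Proof. by rewrite (le_trans (ler_norm _)) // -lecR -normC_normc normc_ge_Re. Qed.

(** The fundamental inequality of calculus along the segment from 1 to k,
    for polynomials: it reduces to monotonicity of the real polynomial
    F - Re (e H), with e a unimodular constant making e H(k) nonnegative. *)
Lemma radial_growth (H : {poly R[i]}) (F : {poly R}) (k : R) : 1 <= k ->
  (forall t, 1 <= t <= k -> normc H^`().[t%:C] <= F^`().[t]) ->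
  normc H.[k%:C] <= normc H.[1] + (F.[k] - F.[1]).
Proof.
move=> k1 HF.
set h := H.[k%:C].
have [e e1 eH] : exists2 e : R[i], normc e = 1 & complex.Re (e * h) = normc h.
  have [h0|h0] := eqVneq h 0; first by exists 1; rewrite ?normc1 // h0 mulr0 normc0.
  have nh : normc h != 0 by apply: contra h0 => /eqP/eq0_normc ->.
  exists ((normc h)%:C / h); last by rewrite divfK.
  rewrite normcM normcV -[X in X / _]/(normc (normc h)%:C) /=.
  by rewrite expr0n addr0 sqrtr_sqr ger0_norm ?normc_ge0 ?divff.
have derF t : t \in `]1, k[ -> 0 <= (F - re_poly (e *: H))^`().[t].
  rewrite in_itv /= => /andP[t1 tk].
  rewrite derivB hornerD hornerN subr_ge0 deriv_re_poly horner_re_poly.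
  rewrite derivZ hornerZ (le_trans (Re_le_normc _)) // normcM e1 mul1r HF //.
  by rewrite !ltW.
have := @ler_hornerW _ 1 k (F - re_poly (e *: H)) derF 1 k.
rewrite !in_itv /= !lexx k1 => /(_ isT isT isT).
rewrite !hornerD !hornerN !horner_re_poly !hornerZ -/h eH.
have := Re_le_normc (e * H.[1%:C]); rewrite normcM e1 mul1r.
rewrite -[1%:C]/(1 : R[i]); lra.
Qed.

End RealPart.

(** * The lower bound for the derivative *)

Section Exponents.
Variables (R : realType) (n : nat) (k : R).
Let e := (n - minn 2 n.-1)%N.

(** Both cases of phi and psi are instances of one formula in the exponent
    e = n - min(2, n-1), the one that comes out of [growth_bound] in degree
    n - 1. *)
Lemma phiE : (1 < n)%N -> phi n k = (k ^+ n - 1) / n%:R - (k ^+ e - 1) / e%:R.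
Proof.
rewrite /phi /e; case: n => [|[|[|m]]] //= _.
  by rewrite /minn /= expr1 divr1; field.
by rewrite (minn_idPl _).
Qed.

Lemma psiE : (1 < n)%N -> 0 < k -> psi n k = 1 - k ^+ e / k ^+ n.
Proof.
rewrite /psi /e => n1 k0; have kN : k != 0 by rewrite gt_eqF.
case: n n1 => [|[|[|m]]] //= _.
  by rewrite /minn /= expr1 expr2; field.
by rewrite (minn_idPl _) // (_ : (m.+3 - 2 = m.+1)%N) // !exprS; field; rewrite expf_neq0.
Qed.

End Exponents.

Section Growth.
Variables (R : realType).
Local Open Scope complex_scope.

Lemma norm1_normc (z : R[i]) : normc z = 1 -> `|z| = 1.
Proof. by rewrite normC_normc => ->. Qed.

Lemma normc_norm1 (z : R[i]) : `|z| = 1 -> normc z = 1.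
Proof. by rewrite normC_normc => -[]. Qed.

Lemma normc_real (x : R) : 0 <= x -> normc x%:C = x.
Proof. by move=> x0; rewrite /= expr0n addr0 sqrtr_sqr ger0_norm. Qed.

(** The derivative on the ray is bounded by [growth_bound] applied to H', whose
    maximum on the circle is at most A = n M / 2; F is a primitive of the resulting
    bound (A - B) t^(n-1) + B t^(e-1), where B = |h_1|. *)
Lemma reversal_growth (n : nat) (G : {poly R[i]}) (M k : R) (z : R[i]) :
  (1 < n)%N -> 1 <= k -> size G = n.+1 -> (forall x, root G x -> `|x| <= 1) ->
  (forall w, normc w = 1 -> normc G.[w] <= M) -> normc z = 1 ->
  normc (reversal n G).[k%:C * z] <= (1 + k ^+ n) / 2 * M - phi n k * normc G`_n.-1.
Proof.
move=> n1 k1 sG G1 GM z1.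
have n0 : (0 < n)%N by exact: ltn_trans n1.
have zC := norm1_normc z1.
have z0 : z != 0 by rewrite -normr_gt0 zC.
set H := reversal n G; set e := (n - minn 2 n.-1)%N.
have e0 : (0 < e)%N.
  by rewrite /e subn_gt0 (leq_ltn_trans (geq_minr _ _)) // prednK.
have nN : n%:R != 0 :> R by rewrite pnatr_eq0 -lt0n.
have eN : e%:R != 0 :> R by rewrite pnatr_eq0 -lt0n.
pose A := M * n%:R / 2; pose B := normc G`_n.-1.
pose F : {poly R} := ((A - B) / n%:R) *: 'X^n + (B / e%:R) *: 'X^e.
have F'E t : F^`().[t] = (A - B) * t ^+ n.-1 + B * t ^+ e.-1.
  rewrite /F derivD !derivZ !derivXn -['X^_ *+ n]scaler_nat -['X^_ *+ e]scaler_nat.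
  by rewrite hornerD !hornerZ !hornerXn; field; apply/andP.
have GMC (w : R[i]) : `|w| = 1 -> `|G.[w]| <= M%:C.
  by move=> w1; rewrite normC_normc lecR GM // normc_norm1.
have H'M (w : R[i]) : `|w| = 1 -> `|H^`().[w]| <= A%:C.
  move=> w1; have := reversal_deriv_bound n0 sG G1 GMC w1.
  by rewrite /A rmorphM fmorphV rmorphM !rmorph_nat.
have sH' : (size H^`() <= n.-1.+1)%N.
  rewrite prednK //; apply/leq_sizeP => i le_ni; rewrite coef_deriv nth_default ?mul0rn //.
  by rewrite (leq_trans (size_reversal _ _)).
have H'0 : H^`()`_0 = G`_n.-1 by rewrite coef_deriv coef_poly ltnS n0 subn1.
have m0 : (0 < n.-1)%N by rewrite -ltnS prednK.
have derbound t : 1 <= t <= k -> normc (H \Po (z *: 'X))^`().[t%:C] <= F^`().[t].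
  move=> /andP[t1 _]; rewrite deriv_dilate normcM z1 mul1r F'E.
  have t1C : 1 <= t%:C by rewrite -[1]/(1%:C) lecR.
  have := growth_bound m0 t1C sH' H'M zC.
  rewrite H'0 normC_normc [`|G`_n.-1|]normC_normc -!rmorphXn -rmorphB -!rmorphM -rmorphD lecR.
  rewrite [z * _]mulrC.
  have -> : (n.-1 - minn 2 n.-1 = e.-1)%N by rewrite /e -[RHS]subn1 subnAC subn1.
  by rewrite -/B; lra.
have := radial_growth k1 derbound.
rewrite !horner_dilate mulr1 [z * _]mulrC => le; apply: (le_trans le).
have H1 : normc H.[z] <= M.
  rewrite -lecR -normC_normc horner_reversal ?sG // normrM normrX zC expr1n mul1r.
  by rewrite GMC // normfV zC invr1.
rewrite /F !hornerD !hornerZ !hornerXn !expr1n !mulr1 phiE // -/e -/B.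
have -> : (1 + k ^+ n) / 2 * M - ((k ^+ n - 1) / n%:R - (k ^+ e - 1) / e%:R) * B
  = M + ((A - B) / n%:R * k ^+ n + B / e%:R * k ^+ e - ((A - B) / n%:R + B / e%:R)).
  by rewrite /A; field; apply/andP.
by rewrite lerD2r.
Qed.

Lemma derivative_lower_bound (n : nat) (k : R) (P : {poly R[i]}) :
  (1 < n)%N -> 1 <= k -> size P = n.+1 -> zeros_in_disk P k ->
  derivative_bound n k P <= circle_max P^`().
Proof.
move=> n1 k1 sP Pk; have n0 : (0 < n)%N by exact: ltn_trans n1.
have k0 : 0 < k by exact: lt_le_trans k1.
have kN : k != 0 by rewrite gt_eqF.
have kCN : k%:C != 0 by rewrite -[0]/(0%:C) (inj_eq (@complexI R)).
have nk : normc k%:C = k by rewrite normc_real // ltW.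
have PnN : P`_n != 0.
  by rewrite (_ : P`_n = lead_coef P) ?lead_coef_eq0 -?size_poly_gt0 ?lead_coefE sP.
pose G := P \Po (k%:C *: 'X).
have Gcoef i : normc G`_i = k ^+ i * normc P`_i.
  by rewrite coef_dilate normcM -rmorphXn normc_real ?exprn_ge0 ?ltW // mulrC.
have sG : size G = n.+1.
  apply/eqP; rewrite eqn_leq -{1}sP size_dilate_le /= ltnNge.
  apply/negP => /leq_sizeP /(_ n (leqnn _)) /eqP.
  by rewrite coef_dilate mulf_eq0 (negPf PnN) expf_eq0 (negPf kCN) andbF.
have G1 x : root G x -> `|x| <= 1.
  rewrite /root horner_dilate => /Pk; rewrite normcM nk => kx.
  by rewrite normC_normc -[1]/(1%:C) lecR -(ler_pM2l k0) mulr1.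
have [[z1 z1n z1M] _] := circle_maxP P.
have [[z2 z2n z2M] GM] := circle_maxP G.
have [_ P'M] := circle_maxP P^`().
(* [reversal_growth] at 1/z1, with z1 a maximum point of |P|. *)
have I1 : k ^+ n * circle_max P <=
    (1 + k ^+ n) / 2 * circle_max G - phi n k * (k ^+ n.-1 * normc P`_n.-1).
  have z1V : normc z1^-1 = 1 by rewrite normcV z1n invr1.
  have z1N : z1 != 0 by rewrite -normr_gt0 norm1_normc.
  have := reversal_growth n1 k1 sG G1 GM z1V; rewrite Gcoef; apply: le_trans.
  rewrite horner_reversal ?sG ?mulf_neq0 ?invr_eq0 // horner_dilate.
  rewrite (_ : k%:C * (k%:C * z1^-1)^-1 = z1); last by field; rewrite kCN z1N.
  rewrite normcM z1M exprMn normcM -rmorphXn normc_real ?exprn_ge0 ?(ltW k0) //.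
  rewrite [normc (z1^-1 ^+ n)]normc_norm1 ?mulr1 //.
  by rewrite normrX (norm1_normc z1V) expr1n.
have z2C := norm1_normc z2n.
have I2 : (n%:R + (normc G`_n - normc G`_0) / (normc G`_n + normc G`_0)) / 2 * circle_max G
    <= k * normc P^`().[k%:C * z2].
  have := deriv_lower sG G1 z2C; rewrite deriv_dilate normrM.
  rewrite ![`|_|]normC_normc nk z2M -!(rmorphD, rmorphB, rmorphM, fmorphV) /=.
  rewrite -(rmorph_nat (@real_complex R) n) -(rmorph_nat (@real_complex R) 2).
  by rewrite -!(rmorphD, rmorphB, rmorphM, fmorphV) lecR.
have I3 : normc P^`().[k%:C * z2] +
    (k ^+ n.-1 - k ^+ (n.-1 - minn 2 n.-1)) * normc P`_1 <= circle_max P^`() * k ^+ n.-1.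
  have m0 : (0 < n.-1)%N by rewrite -ltnS prednK.
  have sP' : (size P^`() <= n.-1.+1)%N.
    rewrite prednK //; apply/leq_sizeP => i le_ni.
    by rewrite coef_deriv nth_default ?mul0rn ?sP.
  have P'MC (w : R[i]) : `|w| = 1 -> `|P^`().[w]| <= (circle_max P^`())%:C.
    by move=> w1; rewrite normC_normc lecR P'M // normc_norm1.
  have k1C : 1 <= k%:C by rewrite -[1]/(1%:C) lecR.
  have := growth_bound m0 k1C sP' P'MC z2C.
  rewrite coef_deriv mulr1n ![`|_|]normC_normc -!rmorphXn -rmorphB -!rmorphM -rmorphD.
  by rewrite lecR.
rewrite /derivative_bound psiE //=; set e := (n - minn 2 n.-1)%N.
have kn : k ^+ n = k * k ^+ n.-1 by rewrite -exprS prednK.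
have ke : k ^+ e = k * k ^+ (n.-1 - minn 2 n.-1).
  rewrite -exprS; congr (_ ^+ _).
  by rewrite -subSn ?geq_minr // prednK.
rewrite !Gcoef expr0 mul1r in I2.
set c := n%:R + _ in I2 *.
have c0 : 0 <= c.
  have a0 : 0 < k ^+ n * normc P`_n + normc P`_0.
    rewrite ltr_wpDr ?normc_ge0 // mulr_gt0 ?exprn_gt0 // lt0r normc_ge0 andbT.
    by apply: contra PnN => /eqP/eq0_normc ->.
  have -> : c = (n%:R - 1) + 2 * (k ^+ n * normc P`_n) / (k ^+ n * normc P`_n + normc P`_0).
    by rewrite /c; field; rewrite gt_eqF.
  rewrite addr_ge0 ?subr_ge0 ?ler1n // divr_ge0 ?(ltW a0) //.
  by rewrite !mulr_ge0 ?exprn_ge0 ?normc_ge0 ?ltW.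
clearbody c; rewrite -(ler_pM2l (exprn_gt0 n k0)).
set K := k ^+ n in I1 I2 kn *.
have K0 : 0 < K by exact: exprn_gt0.
have KN : 1 + K != 0 by rewrite gt_eqF // ltr_wpDl // ltW.
have K'N : K != 0 by rewrite gt_eqF.
(* The quantity c/2 max |G| links I1, which bounds it below, to I2 and I3. *)
have lowG : c * (K * circle_max P + phi n k * (k ^+ n.-1 * normc P`_n.-1)) / (1 + K)
    <= c / 2 * circle_max G.
  rewrite ler_pdivrMr ?addr_gt0 // [c / 2 * _ * _](_ : _ = c * ((1 + K) / 2 * circle_max G)).
    by rewrite ler_wpM2l //; lra.
  by field.
have up : c / 2 * circle_max G <=
    K * circle_max P^`() - (K - k ^+ e) * normc P`_1.
  apply: (le_trans I2); rewrite ke kn -mulrA -mulrBr -mulrA -mulrBr ler_pM2l //.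
  by rewrite [X in X - _]mulrC lerBrDr.
have := le_trans lowG up; move=> le.
have -> : K * (1 / (1 + K) * c * circle_max P + normc P`_n.-1 / (k * (1 + K)) * c * phi n k
    + normc P`_1 * (1 - k ^+ e / K)) =
  c * (K * circle_max P + phi n k * (k ^+ n.-1 * normc P`_n.-1)) / (1 + K)
    + (K - k ^+ e) * normc P`_1.
  have -> : k ^+ n.-1 = K / k by rewrite kn mulrAC divff // mul1r.
  by field; rewrite kN KN K'N.
by rewrite -lerBrDr.
Qed.


End Growth.

(** * The extremal polynomial *)

Section Extremal.
Variables (R : realType) (n : nat) (k : R).
Hypotheses (n1 : (1 < n)%N) (k1 : 1 <= k).
Local Open Scope complex_scope.

Let Q : {poly R[i]} := 'X^n + ((k ^+ n)%:C)%:P.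

Let n0 : (0 < n)%N. Proof. exact: ltn_trans n1. Qed.
Let k0 : 0 <= k. Proof. exact: le_trans k1. Qed.
Let K0 : 0 <= k ^+ n. Proof. exact: exprn_ge0. Qed.

Let coefQ i : Q`_i = (i == n)%:R + (if i == 0%N then (k ^+ n)%:C else 0).
Proof. by rewrite coefD coefXn coefC. Qed.

Lemma normcX (z : R[i]) m : normc (z ^+ m) = normc z ^+ m.
Proof. by elim: m => [|m IH]; rewrite ?normc1 // !exprS normcM IH. Qed.

Lemma size_extremal : size Q = n.+1.
Proof. by rewrite size_XnaddC. Qed.

Lemma zeros_extremal : zeros_in_disk Q k.
Proof.
move=> z /rootP; rewrite hornerD hornerXn hornerC => /eqP.
rewrite addr_eq0 => /eqP /(congr1 (@normc R)).
rewrite normcX normcN normc_real // => E.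
by rewrite -(ler_pXn2r n0) ?nnegrE ?normc_ge0 // E.
Qed.

Lemma circle_max_extremal : circle_max Q = 1 + k ^+ n.
Proof.
have [[z z1 zM] QM] := circle_maxP Q; apply/eqP; rewrite eq_le; apply/andP; split.
  rewrite -zM hornerD hornerXn hornerC (le_trans (le_normcD _ _)) //.
  by rewrite normcX z1 expr1n normc_real.
have := QM 1 (normc1 R); rewrite hornerD hornerXn hornerC expr1n.
by rewrite -(rmorph1 (@real_complex R)) -rmorphD normc_real // addr_ge0.
Qed.

Lemma circle_max_deriv_extremal : circle_max Q^`() = n%:R.
Proof.
have [[z z1 <-] _] := circle_maxP Q^`().
rewrite derivD derivXn derivC addr0 hornerMn hornerXn normcMn normcX z1.
by rewrite expr1n.
Qed.

Lemma extremal_equality : circle_max Q^`() = derivative_bound n k Q.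
Proof.
rewrite circle_max_deriv_extremal /derivative_bound circle_max_extremal.
have n00 : (n == 0)%N = false by rewrite gtn_eqF.
have -> : normc Q`_n = 1 by rewrite coefQ eqxx n00 addr0 normc1.
have -> : normc Q`_0 = k ^+ n by rewrite coefQ eq_sym n00 add0r normc_real.
have -> : normc Q`_1 = 0 by rewrite coefQ ltn_eqF // addr0 normc0.
have -> : normc Q`_n.-1 = 0.
  rewrite coefQ ltn_eqF ?prednK // gtn_eqF ?addr0 ?normc0 //.
  by rewrite -ltnS prednK.
rewrite mulr1 subrr !mul0r !addr0.
by field; rewrite gt_eqF // ltr_wpDr.
Qed.

End Extremal.

Theorem theorem2p1 (R : realType) (n : nat) (k : R)
    (hn : (2 <= n)%N) (hk : 1 <= k) :
  (forall P : {poly R[i]},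
     size P = n.+1 -> zeros_in_disk P k ->
     derivative_bound n k P <= circle_max P^`()) /\
  (let Q : {poly R[i]} := 'X^n + ((k ^+ n)%:C)%C%:P in
   [/\ size Q = n.+1, zeros_in_disk Q k &
       circle_max Q^`() = derivative_bound n k Q]).
Proof.
split=> [P sP Pk|]; first exact: derivative_lower_bound.
by split; [exact: size_extremal|exact: zeros_extremal|exact: extremal_equality].
Qed.
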